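(* Let $(\mathfrak g,[\cdot,\cdot]_{\mathfrak g},\omega)$ be a quadratic Leibniz algebra and let $r\in\mathrm{Sym}^2(\mathfrak g)$. Then $r$ is a solution of the classical Leibniz Yang–Baxter equation $[[r,r]]=0$ in $\mathfrak g$ if and only if $r^\sharp\circ\omega^\natural$ is a Rota–Baxter operator on $(\mathfrak g,[\cdot,\cdot]_{\mathfrak g})$, that is, for all $x,y\in\mathfrak g$, $$[r^\sharp\omega^\natural(x),r^\sharp\omega^\natural(y)]_{\mathfrak g}=(r^\sharp\circ\omega^\natural)[r^\sharp\omega^\natural(x),y]_{\mathfrak g}+(r^\sharp\circ\omega^\natural)[x,r^\sharp\omega^\natural(y)]_{\mathfrak g}.$$
   Context: All vector spaces are finite-dimensional over an algebraically closed field $\mathbb K$ of characteristic $0$. A Leibniz algebra is a vector space with a bilinear operation satisfying $[x,[y,z]]=[[x,y],z]+[y,[x,z]]$. A quadratic Leibniz algebra is a Leibniz algebra with a nondegenerate skew-symmetric bilinear form $\omega$ satisfying $\omega(x,[y,z]_{\mathfrak g})=\omega([x,z]_{\mathfrak g}+[z,x]_{\mathfrak g},y)$. $\omega^\natural:\mathfrak g\to\mathfrak g^*$ is $\langle\omega^\natural(x),y\rangle=\omega(x,y)$. For $r\in\mathfrak g\otimes\mathfrak g$, $r^\sharp:\mathfrak g^*\to\mathfrak g$ is $\langle r^\sharp(\xi),\eta\rangle=\langle r,\xi\otimes\eta\rangle$. $L^*,R^*:\mathfrak g\to\mathfrak{gl}(\mathfrak g^* )$ are defined by $\langle L_x^*\xi,y\rangle=-\langle\xi,[x,y]_{\mathfrak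 g}\rangle$, $\langle R_x^*\xi,y\rangle=-\langle\xi,[y,x]_{\mathfrak g}\rangle$. The bracket $[[\cdot,\cdot]]:\otimes^2\mathfrak g\times\otimes^2\mathfrak g\to\otimes^3\mathfrak g$ is $\langle[[P,Q]],\xi_1\otimes\xi_2\otimes\xi_3\rangle=\langle\{P^\sharp,Q^\sharp\}(\xi_1,\xi_2),\xi_3\rangle$, where for $f,g\in\mathrm{Hom}(\mathfrak g^*,\mathfrak g)$ $$\{f,g\}(\xi_1,\xi_2)=-f(L^*_{g\xi_1}\xi_2)+f(L^*_{g\xi_2}\xi_1)+f(R^*_{g\xi_2}\xi_1)+[g\xi_1,f\xi_2]_{\mathfrak g}+[f\xi_1,g\xi_2]_{\mathfrak g}-g(L^*_{f\xi_1}\xi_2)+g(L^*_{f\xi_2}\xi_1)+g(R^*_{f\xi_2}\xi_1).$$ *)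

(* Defs.v *)
From HB Require Import structures.
From mathcomp Require Import all_boot all_order all_algebra.

Set Implicit Arguments.
Unset Strict Implicit.
Unset Printing Implicit Defensive.

Import GRing.Theory.
Local Open Scope ring_scope.

Section Duality.
Variables (K : fieldType).
Implicit Types U V W : vectType K.

Definition dual V : vectType K := 'Hom(V, K^o).

Definition eval_dual V (x : V) : dual (dual V) :=
  linfun (fun xi : dual V => xi x).

(* The canonical map V -> V**; bijective by [biduality_inj] and
   [biduality_bij], as V is finite-dimensional. *)
Definition biduality V : 'Hom(V, dual (dual V)) := linfun (@eval_dual V).

(* Finite-dimensional tensor products, realised as multilinear forms on the
   duals: the pairing <t, xi (x) eta> is application, t xi eta.  See
   [tensor2_universal] and [tensor3_universal]. *)
Definition tensor2 U V : vectType K := 'Hom(dual U, dual (dual V)).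
Definition tensor3 U V W : vectType K := 'Hom(dual U, tensor2 V W).

Definition pure2 U V (x : U) (y : V) : tensor2 U V :=
  linfun (fun xi : dual U => xi x *: biduality V y).
Definition pure3 U V W (x : U) (y : V) (z : W) : tensor3 U V W :=
  linfun (fun xi : dual U => xi x *: pure2 y z).

Definition swap U V (t : tensor2 U V) : tensor2 V U :=
  linfun (fun eta : dual V =>
    linfun (fun xi : dual U => t xi eta : K^o) : dual (dual U)).

Definition Sym2 V : {vspace tensor2 V V} := fixedSpace (linfun (@swap V V)).

(* r^# : V* -> V: r itself is a map V* -> V**, read back in V by biduality;
   see [sharpE]. *)
Definition sharp V (r : tensor2 V V) : 'Hom(dual V, V) :=
  ((biduality V)^-1 \o r)%VF.

Definition flat V (om : V -> V -> K) : 'Hom(V, dual V) :=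
  linfun (fun x => linfun (om x : V -> K^o) : dual V).

Lemma eval_dualE V (x : V) (xi : dual V) : eval_dual x xi = xi x.
Proof.
have lin : linear (fun xi : dual V => xi x).
  by move=> a f h; rewrite add_lfunE scale_lfunE.
pose A := GRing.isLinear.Build _ _ _ _ _ lin.
pose F : {linear dual V -> K^o} := HB.pack (fun xi : dual V => xi x) A.
exact: (lfunE F).
Qed.

Lemma linfunE V W (f : V -> W) : linear f -> forall x, linfun f x = f x.
Proof.
move=> lin; pose A := GRing.isLinear.Build _ _ _ _ _ lin.
pose F : {linear V -> W} := HB.pack f A; exact: (lfunE F).
Qed.

Lemma linear_add V W (f h : V -> W) :
  linear f -> linear h -> linear (fun x => f x + h x).
Proof.
by move=> fL hL a u v; rewrite fL hL scalerDr addrACA.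
Qed.

Lemma linear_opp V W (f : V -> W) : linear f -> linear (fun x => - f x).
Proof. by move=> fL a u v; rewrite fL opprD scalerN. Qed.

Lemma bidualityE V (x : V) (xi : dual V) : biduality V x xi = xi x.
Proof.
rewrite /biduality linfunE ?eval_dualE // => a u v.
apply/lfunP=> f; rewrite add_lfunE scale_lfunE !eval_dualE.
by rewrite linearP.
Qed.

Lemma pure2E U V (x : U) (y : V) (xi : dual U) (eta : dual V) :
  pure2 x y xi eta = xi x * eta y.
Proof.
rewrite /pure2 linfunE; first by rewrite scale_lfunE bidualityE.
by move=> a u v; rewrite add_lfunE scale_lfunE scalerDl scalerA.
Qed.

Lemma pure3E U V W (x : U) (y : V) (z : W)
    (xi : dual U) (eta : dual V) (zeta : dual W) :
  pure3 x y z xi eta zeta = xi x * eta y * zeta z.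
Proof.
rewrite /pure3 linfunE; first by rewrite !scale_lfunE pure2E -mulrA.
by move=> a u v; rewrite add_lfunE scale_lfunE scalerDl scalerA.
Qed.

Lemma swapE U V (t : tensor2 U V) xi eta : swap t eta xi = t xi eta.
Proof.
have lin0 e : linear (fun xi : dual U => t xi e : K^o).
  by move=> a u v; rewrite linearP add_lfunE scale_lfunE.
rewrite /swap linfunE; first by rewrite linfunE.
move=> a u v; apply/lfunP=> f.
by rewrite add_lfunE scale_lfunE !linfunE // linearP.
Qed.

Lemma Sym2P V (r : tensor2 V V) :
  reflect (forall xi eta, r xi eta = r eta xi) (r \in Sym2 V).
Proof.
have swapL : linfun (@swap V V) r = swap r.
  rewrite linfunE // => a t u; apply/lfunP=> x; apply/lfunP=> y.
  by rewrite !(add_lfunE, scale_lfunE, swapE).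
apply: (iffP fixedSpaceP); rewrite swapL; [move=> rS xi eta | move=> rS].
  by rewrite -[in LHS]rS swapE.
by apply/lfunP=> xi; apply/lfunP=> eta; rewrite swapE rS.
Qed.

Section Basis.
Variable V : vectType K.
Local Notation n := (\dim {:V}).
Local Notation e i := (vbasis {:V})`_i.

Definition dual_basis (i : 'I_n) : dual V := linfun (coord (vbasis {:V}) i : V -> K^o).

Lemma dual_basisE i x : dual_basis i x = coord (vbasis {:V}) i x.
Proof. exact: lfunE. Qed.

Lemma vbasis_expand (x : V) : x = \sum_i dual_basis i x *: e i.
Proof.
rewrite [LHS](coord_vbasis (memvf x)); apply: eq_bigr => i _.
by rewrite dual_basisE.
Qed.

Lemma dual_expand (xi : dual V) : xi = \sum_(i < n) xi (e i) *: dual_basis i.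
Proof.
apply/lfunP=> x; rewrite [in LHS](vbasis_expand x) linear_sum sum_lfunE.
apply: eq_bigr => i _; rewrite linearZ scale_lfunE /=.
exact: mulrC.
Qed.

Lemma biduality_inj : injective (biduality V).
Proof.
move=> x y eq_xy; rewrite [x]vbasis_expand [y]vbasis_expand.
apply: eq_bigr => i _; congr (_ *: _).
by rewrite -[LHS]bidualityE -[RHS]bidualityE eq_xy.
Qed.

Lemma bidualityVK : cancel (biduality V)^-1%VF (biduality V).
Proof.
move=> F; apply: limg_lfunVK.
have -> : F = biduality V (\sum_i F (dual_basis i) *: e i).
  apply/lfunP=> xi; rewrite bidualityE linear_sum {1}[xi]dual_expand linear_sum.
  by apply: eq_bigr => i _; rewrite !linearZ /=; exact: mulrC.
exact: memv_img (memvf _).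
Qed.

Lemma biduality_bij : bijective (biduality V).
Proof.
exists (biduality V)^-1%VF; last exact: bidualityVK.
by apply: lker0_lfunK; apply/lker0P; apply: biduality_inj.
Qed.

Lemma sharpE (r : tensor2 V V) (xi eta : dual V) :
  eta (sharp r xi) = r xi eta.
Proof. by rewrite -bidualityE comp_lfunE bidualityVK. Qed.

End Basis.

Lemma tensor2_expand U V (t : tensor2 U V) :
  t = \sum_i \sum_j t (dual_basis i) (dual_basis j) *:
        pure2 (vbasis {:U})`_i (vbasis {:V})`_j.
Proof.
apply/lfunP=> xi; apply/lfunP=> eta.
rewrite {1}[xi]dual_expand linear_sum !sum_lfunE; apply: eq_bigr => i _.
rewrite linearZ scale_lfunE {1}[eta]dual_expand linear_sum /=.
rewrite sum_lfunE scaler_sumr sum_lfunE; apply: eq_bigr => j _.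
by rewrite linearZ !scale_lfunE pure2E /= /GRing.scale /= mulrA mulrC.
Qed.

Lemma tensor3_expand U V W (t : tensor3 U V W) :
  t = \sum_i \sum_j \sum_k
        t (dual_basis i) (dual_basis j) (dual_basis k) *:
        pure3 (vbasis {:U})`_i (vbasis {:V})`_j (vbasis {:W})`_k.
Proof.
apply/lfunP=> xi; rewrite {1}[xi]dual_expand linear_sum sum_lfunE.
apply: eq_bigr => i _; rewrite linearZ /= [t _ in LHS]tensor2_expand.
rewrite sum_lfunE scaler_sumr; apply: eq_bigr => j _.
rewrite sum_lfunE scaler_sumr; apply: eq_bigr => k _.
apply/lfunP=> eta; apply/lfunP=> zeta.
rewrite !scale_lfunE pure2E pure3E /GRing.scale /=.
by rewrite !mulrA; congr (_ * _ * _); exact: mulrC.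
Qed.

Lemma tensor2_universal U V W (f : {bilinear U -> V -> W}) :
  exists! F : 'Hom(tensor2 U V, W), forall x y, F (pure2 x y) = f x y.
Proof.
pose F0 (t : tensor2 U V) : W :=
  \sum_i \sum_j t (dual_basis i) (dual_basis j) *:
    f (vbasis {:U})`_i (vbasis {:V})`_j.
have F0L : linear F0.
  move=> a t u; rewrite /F0 scaler_sumr -big_split /=; apply: eq_bigr => i _.
  rewrite scaler_sumr -big_split /=; apply: eq_bigr => j _.
  by rewrite !(add_lfunE, scale_lfunE) scalerDl scalerA.
have F0E x y : linfun F0 (pure2 x y) = f x y.
  rewrite linfunE // /F0 [in RHS](vbasis_expand x) linear_sumlz.
  apply: eq_bigr => i _.
  rewrite [in RHS](vbasis_expand y) linear_sumr; apply: eq_bigr => j _.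
  by rewrite pure2E linearZlr /= scalerA.
exists (linfun F0); split=> // G GE; apply/lfunP=> t.
rewrite [t]tensor2_expand !linear_sum; apply: eq_bigr => i _.
rewrite !linear_sum; apply: eq_bigr => j _.
by rewrite !linearZ /= GE F0E.
Qed.

Lemma tensor3_universal U V W (X : vectType K)
    (f : U -> V -> W -> X)
    (f1 : forall y z, linear (fun x => f x y z))
    (f2 : forall x z, linear (fun y => f x y z))
    (f3 : forall x y, linear (f x y)) :
  exists! F : 'Hom(tensor3 U V W, X), forall x y z, F (pure3 x y z) = f x y z.
Proof.
have expand (T : vectType K) (h : T -> X) (hL : linear h) (x : T) :
    h x = \sum_i dual_basis i x *: h (vbasis {:T})`_i.
  rewrite -(linfunE hL) {1}[x]vbasis_expand linear_sum.
  by apply: eq_bigr => i _; rewrite linearZ /= linfunE.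
pose F0 (t : tensor3 U V W) : X :=
  \sum_i \sum_j \sum_k t (dual_basis i) (dual_basis j) (dual_basis k) *:
    f (vbasis {:U})`_i (vbasis {:V})`_j (vbasis {:W})`_k.
have F0L : linear F0.
  move=> a t u; rewrite /F0 scaler_sumr -big_split /=; apply: eq_bigr => i _.
  rewrite scaler_sumr -big_split /=; apply: eq_bigr => j _.
  rewrite scaler_sumr -big_split /=; apply: eq_bigr => k _.
  by rewrite !(add_lfunE, scale_lfunE) scalerDl scalerA.
have F0E x y z : linfun F0 (pure3 x y z) = f x y z.
  rewrite linfunE // /F0 (expand _ _ (f1 y z) x); apply: eq_bigr => i _.
  rewrite (expand _ _ (f2 _ z) y) scaler_sumr; apply: eq_bigr => j _.
  rewrite (expand _ _ (f3 _ _) z) !scaler_sumr; apply: eq_bigr => k _.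
  by rewrite pure3E !scalerA.
exists (linfun F0); split=> // G GE; apply/lfunP=> t.
rewrite [t]tensor3_expand !linear_sum; apply: eq_bigr => i _.
rewrite !linear_sum; apply: eq_bigr => j _.
rewrite !linear_sum; apply: eq_bigr => k _.
by rewrite !linearZ /= GE F0E.
Qed.

End Duality.

Section Leibniz.
Variables (K : fieldType) (g : vectType K).
Variable br : {bilinear g -> g -> g}.

Definition leibniz : Prop :=
  forall x y z, br x (br y z) = br (br x y) z + br y (br x z).

Definition quadratic_leibniz (om : {skew_symmetric g}) : Prop :=
  [/\ leibniz, nondegenerate om &
      forall x y z, om x (br y z) = om (br x z + br z x) y].

Definition Lstar (x : g) : 'End(dual g) :=
  linfun (fun xi : dual g => linfun (fun y => - xi (br x y) : K^o) : dual g).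
Definition Rstar (x : g) : 'End(dual g) :=
  linfun (fun xi : dual g => linfun (fun y => - xi (br y x) : K^o) : dual g).

Definition hom_bracket (f h : 'Hom(dual g, g)) (xi1 xi2 : dual g) : g :=
  - f (Lstar (h xi1) xi2) + f (Lstar (h xi2) xi1) + f (Rstar (h xi2) xi1)
  + br (h xi1) (f xi2) + br (f xi1) (h xi2)
  - h (Lstar (f xi1) xi2) + h (Lstar (f xi2) xi1) + h (Rstar (f xi2) xi1).

(* See [tensor_bracketE]. *)
Definition tensor_bracket (P Q : tensor2 g g) : tensor3 g g g :=
  linfun (fun xi1 : dual g =>
    linfun (fun xi2 : dual g =>
      biduality g (hom_bracket (sharp P) (sharp Q) xi1 xi2)) : tensor2 g g).

Definition rota_baxter (B : 'End(g)) : Prop :=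
  forall x y, br (B x) (B y) = B (br (B x) y) + B (br x (B y)).

Lemma LstarE x (xi : dual g) y : Lstar x xi y = - xi (br x y).
Proof.
have lin0 (f : dual g) : linear (fun y => - f (br x y) : K^o).
  by move=> a u v; rewrite linearPr linearP opprD scalerN.
rewrite /Lstar linfunE; first by rewrite linfunE.
move=> a u v; apply/lfunP=> z.
rewrite add_lfunE scale_lfunE 3?(linfunE (lin0 _)).
by rewrite add_lfunE scale_lfunE opprD scalerN.
Qed.

Lemma RstarE x (xi : dual g) y : Rstar x xi y = - xi (br y x).
Proof.
have lin0 (f : dual g) : linear (fun y => - f (br y x) : K^o).
  by move=> a u v; rewrite linearPl linearP opprD scalerN.
rewrite /Rstar linfunE; first by rewrite linfunE.
move=> a u v; apply/lfunP=> z.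
rewrite add_lfunE scale_lfunE 3?(linfunE (lin0 _)).
by rewrite add_lfunE scale_lfunE opprD scalerN.
Qed.

Lemma Lstar_linear : linear Lstar.
Proof.
move=> a x y; apply/lfunP=> xi; apply/lfunP=> z.
by rewrite !(add_lfunE, scale_lfunE, LstarE) linearPl linearP opprD scalerN.
Qed.

Lemma Rstar_linear : linear Rstar.
Proof.
move=> a x y; apply/lfunP=> xi; apply/lfunP=> z.
by rewrite !(add_lfunE, scale_lfunE, RstarE) linearPr linearP opprD scalerN.
Qed.

Lemma flatE (om : {skew_symmetric g}) x y : flat om x y = om x y.
Proof.
have lin z : linear (om z : g -> K^o) by move=> a u v; rewrite linearPr.
rewrite /flat linfunE; first by rewrite (linfunE (lin x)).
move=> a u v; apply/lfunP=> z; rewrite add_lfunE scale_lfunE.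
by rewrite 3?(linfunE (lin _)) linearPl.
Qed.

Lemma hom_bracket_linearl f h xi2 : linear (hom_bracket f h ^~ xi2).
Proof.
rewrite /hom_bracket; repeat first [apply: linear_add | apply: linear_opp];
  move=> a u v;
  by rewrite ?linearP ?Lstar_linear ?(add_lfunE, scale_lfunE) ?linearPl ?linearP.
Qed.

Lemma hom_bracket_linearr f h xi1 : linear (hom_bracket f h xi1).
Proof.
rewrite /hom_bracket; repeat first [apply: linear_add | apply: linear_opp];
  move=> a u v;
  by rewrite ?linearP ?Lstar_linear ?Rstar_linear ?(add_lfunE, scale_lfunE)
             ?linearPr ?linearP.
Qed.

Lemma tensor_bracketE P Q (xi1 xi2 xi3 : dual g) :
  tensor_bracket P Q xi1 xi2 xi3 = xi3 (hom_bracket (sharp P) (sharp Q) xi1 xi2).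
Proof.
have linr xi : linear (fun xi2 : dual g =>
    biduality g (hom_bracket (sharp P) (sharp Q) xi xi2)).
  by move=> a u v; rewrite hom_bracket_linearr linearP.
rewrite /tensor_bracket linfunE; first by rewrite (linfunE (linr _)) bidualityE.
move=> a u v; apply/lfunP=> xi; rewrite add_lfunE scale_lfunE.
by rewrite 3?(linfunE (linr _)) hom_bracket_linearl linearP.
Qed.

End Leibniz.

(* Main.v *)
(* Write B for r^# o omega^natural.  Invariance of omega says that
   L^*_u (omega^natural y) = omega^natural [u, y] and
   (L^*_u + R^*_u) (omega^natural x) = - omega^natural [x, u].  Substituting
   xi_1 = omega^natural x and xi_2 = omega^natural y turns {r^#, r^#}(xi_1, xi_2)
   into twice the Rota-Baxter defect of B at (x, y), and omega^natural is onto. *)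

Require Import Defs.
From mathcomp Require Import all_boot all_order all_algebra.
Import GRing.Theory.
Local Open Scope ring_scope.

Lemma dim_dual (K : fieldType) (V : vectType K) : dim (dual V) = dim V.
Proof. by rewrite [LHS]muln1. Qed.

Lemma skew_formC (K : fieldType) (V : vectType K) (om : {skew_symmetric V}) x y :
  om x y = - om y x.
Proof. by rewrite hermC /= expr1 mulN1r. Qed.

(** A kernel vector is orthogonal to everything, and [nondegenerate] says that the orthogonal of the
    full space is zero. *)
Lemma flat_lker0 (K : fieldType) (V : vectType K) (om : {skew_symmetric V}) :
  nondegenerate om -> lker (flat om) == 0%VS.
Proof.
move=> om_nd; rewrite -subv0 -(eqP om_nd); apply/subvP=> x.
rewrite memv_ker => /eqP flat_x0; apply/mem_orthovP=> y _.
by rewrite -flatE flat_x0 zero_lfunE.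
Qed.

(** An injective map between spaces of equal dimension is onto. *)
Lemma flat_surj (K : fieldType) (V : vectType K) (om : {skew_symmetric V}) :
  nondegenerate om -> forall xi, exists x, xi = flat om x.
Proof.
move=> om_nd xi.
have: xi \in limg (flat om).
  suff /eqP-> : limg (flat om) == fullv by rewrite memvf.
  rewrite eqEdim subvf limg_dim_eq; last first.
    by rewrite (eqP (flat_lker0 _ _ _ om_nd)) capv0.
  by rewrite !dimvf dim_dual leqnn.
by case/memv_imgP=> x _ ->; exists x.
Qed.

Section QuadraticLeibniz.
Variables (K : fieldType) (g : vectType K) (br : {bilinear g -> g -> g}).
Variable om : {skew_symmetric g}.
Hypothesis quad : quadratic_leibniz br om.

(** At [z], invariance turns both sides into [- om (br y z + br z y) u], up to the order of the two
    brackets. *)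
Lemma Lstar_flat u y : Lstar br u (flat om y) = flat om (br u y).
Proof.
case: quad => _ _ inv; apply/lfunP=> z.
by rewrite LstarE !flatE [om (br u y) z]skew_formC !inv addrC.
Qed.

(** The sum evaluates [om x] on the symmetrised bracket [br u z + br z u], which invariance trades
    for a single bracket. *)
Lemma LRstar_flat u x :
  Lstar br u (flat om x) + Rstar br u (flat om x) = - flat om (br x u).
Proof.
case: quad => _ _ inv; apply/lfunP=> z.
rewrite add_lfunE opp_lfunE LstarE RstarE !flatE -opprD -linearDr addrC.
by rewrite [om (br x u) z]skew_formC inv opprK -skew_formC.
Qed.

(** With both arguments equal to [f], the eight terms split into two equal halves. *)
Lemma hom_bracket_flat (f : 'Hom(dual g, g)) (x y : g) (B := (f \o flat om)%VF) :
  hom_bracket br f f (flat om x) (flat om y) =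
  (br (B x) (B y) - (B (br (B x) y) + B (br x (B y)))) *+ 2.
Proof.
have BE z : f (flat om z) = B z by rewrite comp_lfunE.
have LRB u : f (Lstar br u (flat om x)) + f (Rstar br u (flat om x)) =
    - B (br x u).
  by rewrite -linearD LRstar_flat -[in RHS]BE [LHS]linearN.
rewrite /hom_bracket ![Lstar _ _ (flat om y)]Lstar_flat !BE.
rewrite -[- _ + _ + _]addrA LRB -[X in X = _]addrA LRB -[X in X = _]addrA.
(* With [b = br (B x) (B y)], the goal becomes [d + b + b + d = b + d + (b + d)]. *)
rewrite mulr2n opprD; set d := - _ - _.
by rewrite [d + _]addrC !addrA.
Qed.

End QuadraticLeibniz.

Theorem corollary4p18 (K : closedFieldType) (charK0 : [pchar K] =i pred0)
    (g : vectType K) (br : {bilinear g -> g -> g}) (om : {skew_symmetric g})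
    (quad : quadratic_leibniz br om)
    (r : tensor2 g g) (rS : r \in Sym2 g) :
  tensor_bracket br r r = 0 <-> rota_baxter br (sharp r \o flat om)%VF.
Proof.
have om_nd : nondegenerate om by case: quad.
(* Characteristic 0 allows the factor 2 of [hom_bracket_flat] to be cancelled. *)
have two_neq0 : 2%:R != 0 :> K by rewrite ((pcharf0P K).1 charK0).
split=> [r0 x y | rb].
- have /eqP : hom_bracket br (sharp r) (sharp r) (flat om x) (flat om y) = 0.
    (* A vector killed by every covector is zero. *)
    apply: biduality_inj; apply/lfunP=> zeta.
    by rewrite linear0 bidualityE -tensor_bracketE r0 !zero_lfunE.
  rewrite (hom_bracket_flat _ _ _ _ quad) -scaler_nat scaler_eq0.
  by rewrite (negPf two_neq0) subr_eq0 => /eqP.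
- apply/lfunP=> xi1; apply/lfunP=> xi2; apply/lfunP=> xi3.
  have [x ->] := flat_surj _ _ _ om_nd xi1.
  have [y ->] := flat_surj _ _ _ om_nd xi2.
  rewrite tensor_bracketE (hom_bracket_flat _ _ _ _ quad) rb subrr mul0rn.
  by rewrite linear0 !zero_lfunE.
Qed.
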